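(* Let $\mathcal{P}=(\mathcal{S},\mathcal{F},\mathrm{val})$ be an optimization problem with guarantees $C,S$ and $(C,S)$-approximate slack matrix $M$, and let $\widetilde M$ be a nonnegative matrix of the same dimensions ($\mathcal{F}^{\mathcal{S}}\times\mathcal{S}$). Define the adjusted completeness guarantee \[ C'(f)=C(f)+(\operatorname{rank}M+\operatorname{rank}\widetilde M)\,\|\widetilde M-M\|_\infty \] if $\mathcal{P}$ is a maximization problem, and \[ C'(f)=C(f)-(\operatorname{rank}M+\operatorname{rank}\widetilde M)\,\|\widetilde M-M\|_\infty \] if $\mathcal{P}$ is a minimization problem. Then \[ \mathrm{fc}(\mathcal{P},C',S)\le\operatorname{rank}_{\mathrm{LP}}\widetilde M+2(\operatorname{rank}M+\operatorname{rank}\widetilde M), \] \[ \mathrm{fc}_+(\mathcal{P},C',S)\le\operatorname{rank}_{\mathrm{SDP}}\widetilde M+2(\operatorname{rank}M+\operatorname{rank}\widetilde M). \]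
   Context: An optimization problem $\mathcal{P}=(\mathcal{S},\mathcal{F},\mathrm{val})$ consists of feasible solutions $\mathcal{S}$, instances $\mathcal{F}$, and $\mathrm{val}\colon\mathcal{S}\times\mathcal{F}\to\mathbb{R}$, written $\mathrm{val}_f(s)$. It is a maximization or a minimization problem. Guarantees are real functions $C$ (completeness) and $S$ (soundness) on $\mathcal{F}$. $\mathcal{F}^{\mathcal{S}}=\{f:\max_s\mathrm{val}_f(s)\le S(f)\}$ for maximization and $\{f:\min_s\mathrm{val}_f(s)\ge S(f)\}$ for minimization. The $(C,S)$-approximate slack matrix $M$ is the $\mathcal{F}^{\mathcal{S}}\times\mathcal{S}$ matrix with $M(f,s)=C(f)-\mathrm{val}_f(s)$ (maximization) or $\mathrm{val}_f(s)-C(f)$ (minimization). A $(C,S)$-approximate LP formulation consists of: - a system $Ax\le b$ ($x\in\mathbb{R}^d$); - $x^s$ with $Ax^s\le b$ for all $s\in\mathcal{S}$; - affine $w^f$ ($f\in\mathcal{F}^{\mathcal{S}}$) with $w^f(x^s)=\mathrm{val}_f(s)$; - the requirement $\max\{w^f(x):Ax\le b\}\le C(f)$ (resp. $\min\ge C(f)$ for minimization). Its size is the number of inequalities, and $\mathrm{fc}(\mathcal{P},C,S)$ is the minimal size. A $(C,S)$-approximate SDP formulation consists of: - a linear map $\mathcal{A}\colon\mathbb{S}^d\to\mathbb{R}^k$ and $b$; - $X^s\in\mathbb{S}^d_+$ with $\mathcal{A}(X^s)=b$; - affine $w^f$ with $w^f(X^s)=\mathrm{val}_f(s)$; - the requirement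 $\sup\{w^f(X):X\succeq0,\mathcal{A}(X)=b\}\le C(f)$ (resp. $\inf\ge C(f)$). Its size is $d$, and $\mathrm{fc}_+$ is the minimal size. For a nonnegative $m\times n$ matrix $N$: - $\operatorname{rank}_{\mathrm{LP}}N$ is the minimal $r$ with $N=TU+\mu\mathbb{1}$, where $T\in\mathbb{R}_+^{m\times r}$, $U\in\mathbb{R}_+^{r\times n}$, $\mu\in\mathbb{R}_+^{m\times1}$ and $\mathbb{1}$ is the all-ones $1\times n$ matrix; - $\operatorname{rank}_{\mathrm{SDP}}N$ is the minimal $r$ with psd $r\times r$ matrices $T_i,U_j$ and $\mu\in\mathbb{R}_+^m$ such that $N_{ij}=\operatorname{tr}[T_iU_j]+\mu(i)$. $\operatorname{rank}$ denotes the usual linear rank, and $\|\cdot\|_\infty$ the maximum absolute value of the entries. *)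

(* Defs.v *)
From HB Require Import structures.
From mathcomp Require Import all_boot all_order all_algebra.
From mathcomp Require Import mathcomp_extra boolp classical_sets reals ereal.
From mathcomp Require Import constructive_ereal.

Set Implicit Arguments.
Unset Strict Implicit.
Unset Printing Implicit Defensive.
Import Order.TTheory GRing.Theory Num.Theory.
Local Open Scope classical_set_scope.
Local Open Scope ring_scope.

(* The minimum of a set of natural numbers, as an extended real: for a nonempty
   set the infimum is attained, and it is +oo when no size is realizable. *)
Definition min_size (R : realType) (D : set nat) : \bar R :=
  ereal_inf [set (n%:R%:E : \bar R) | n in D].

(* Matrices are functions N : I -> J -> R on arbitrary index types, since the
   sets of instances and of feasible solutions need not be finite. *)

(* r rows of N are linearly independent. *)
Definition independent_rows (R : realType) (I J : Type) (N : I -> J -> R)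
    (r : nat) (i : 'I_r -> I) : Prop :=
  forall c : 'I_r -> R,
    (forall j, \sum_(k < r) c k * N (i k) j = 0) -> forall k, c k = 0.

(* N has (finite) rank r; [linear_rankP] relates this to [mxrank]. *)
Definition linear_rank (R : realType) (I J : Type) (N : I -> J -> R)
    (r : nat) : Prop :=
  (exists i : 'I_r -> I, independent_rows N i) /\
  (forall (q : nat) (i : 'I_q -> I), independent_rows N i -> (q <= r)%N).

Definition entries (R : realType) (I J : Type) (N : I -> J -> R) : set R :=
  [set `|N p.1 p.2| | p in [set: I * J]].

(* Meaningful only when [entries N] is bounded above; 0 if N has no entry. *)
Definition max_norm (R : realType) (I J : Type) (N : I -> J -> R) : R :=
  sup (entries N).

Definition psd (R : realType) (d : nat) (X : 'M[R]_d) : Prop :=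
  X^T = X /\ forall v : 'cV[R]_d, 0 <= (v^T *m X *m v) 0 0.

Definition rank_LP (R : realType) (I J : Type) (N : I -> J -> R) : \bar R :=
  min_size R [set r | exists (T : I -> 'I_r -> R) (U : 'I_r -> J -> R)
                             (mu : I -> R),
    [/\ forall i k, 0 <= T i k,
        forall k j, 0 <= U k j,
        forall i, 0 <= mu i &
        forall i j, N i j = \sum_(k < r) T i k * U k j + mu i]].

Definition rank_SDP (R : realType) (I J : Type) (N : I -> J -> R) : \bar R :=
  min_size R [set r | exists (T : I -> 'M[R]_r) (U : J -> 'M[R]_r)
                             (mu : I -> R),
    [/\ forall i, psd (T i),
        forall j, psd (U j),
        forall i, 0 <= mu i &
        forall i j, N i j = \tr (T i *m U j) + mu i]].

Definition affine (R : realType) (V : lmodType R) (w : V -> R) : Prop :=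
  exists (l : V -> R^o) (c : R), linear l /\ forall x, w x = l x + c.

(* The space S^d of real symmetric d x d matrices. *)
Section SymmetricMatrices.
Variables (R : realType) (d : nat).

Definition is_symmx : {pred 'M[R]_d} := fun X => X^T == X.

Lemma is_symmx_submod_closed : submod_closed is_symmx.
Proof.
split=> [|a X Y /eqP sX /eqP sY]; rewrite unfold_in ?trmx0 //.
by rewrite linearD linearZ /= sX sY.
Qed.

HB.instance Definition _ :=
  GRing.isSubmodClosed.Build R 'M[R]_d is_symmx is_symmx_submod_closed.

Record symmx := SymMx { symmx_val : 'M[R]_d; symmxP : symmx_val \in is_symmx }.

HB.instance Definition _ := [isSub for symmx_val].
HB.instance Definition _ := [Choice of symmx by <:].
HB.instance Definition _ := [SubChoice_isSubLmodule of symmx by <:].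

End SymmetricMatrices.

Variant objective_sense := Maximize | Minimize.

Record opt_problem (R : realType) := OptProblem {
  sol : Type;
  inst : Type;
  objval : inst -> sol -> R;
  sense : objective_sense
}.

(* "The optimum of the values in D is at most (Maximize), resp. at least
   (Minimize), a".  Suprema and infima are taken in the extended reals. *)
Definition opt_within (R : realType) (o : objective_sense) (D : set R) (a : R) :
    Prop :=
  match o with
  | Maximize => (ereal_sup [set x%:E | x in D] <= a%:E)%E
  | Minimize => (a%:E <= ereal_inf [set x%:E | x in D])%E
  end.

Section Formulations.
Variables (R : realType) (P : opt_problem R).
Implicit Types C S : inst P -> R.

(* The instances whose optimum respects the soundness guarantee: F^S. *)
Definition sound S : set (inst P) :=
  [set f | opt_within (sense P) (range (objval f)) (S f)].

Definition sound_inst S : Type := {f : inst P | sound S f}.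

Definition slack C S (f : sound_inst S) (s : sol P) : R :=
  match sense P with
  | Maximize => C (sval f) - objval (sval f) s
  | Minimize => objval (sval f) s - C (sval f)
  end.

Definition LP_formulation C S (n : nat) : Prop :=
  exists (d : nat) (A : 'M[R]_(n, d)) (b : 'cV[R]_n)
         (x : sol P -> 'cV[R]_d) (w : sound_inst S -> 'cV[R]_d -> R),
    let feasible := [set y : 'cV[R]_d | forall i, (A *m y) i 0 <= b i 0] in
    [/\ forall s, feasible (x s),
        forall f, affine (w f),
        forall f s, w f (x s) = objval (sval f) s &
        forall f, opt_within (sense P) (w f @` feasible) (C (sval f))].

Definition SDP_formulation C S (d : nat) : Prop :=
  exists (k : nat) (A : symmx R d -> 'cV[R]_k) (b : 'cV[R]_k)
         (X : sol P -> symmx R d) (w : sound_inst S -> symmx R d -> R),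
    let feasible := [set Y : symmx R d | psd (symmx_val Y) /\ A Y = b] in
    linear A /\
    [/\ forall s, feasible (X s),
        forall f, affine (w f),
        forall f s, w f (X s) = objval (sval f) s &
        forall f, opt_within (sense P) (w f @` feasible) (C (sval f))].

Definition fc C S : \bar R := min_size R (LP_formulation C S).

Definition fc_plus C S : \bar R := min_size R (SDP_formulation C S).

Definition adjusted C (t : R) (f : inst P) : R :=
  match sense P with
  | Maximize => C f + t
  | Minimize => C f - t
  end.

End Formulations.

Section FiniteMatrices.
Variables (R : realType) (m n : nat) (A : 'M[R]_(m, n)).

Lemma independent_rowsP (r : nat) (i : 'I_r -> 'I_m) :
  independent_rows (fun i j => A i j) i <-> row_free (rowsub i A).
Proof.
split=> [h|/row_free_inj inj c hc k].
  rewrite -kermx_eq0; apply/eqP/row_matrixP => l; rewrite row0.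
  have /sub_kermxP e : (row l (kermx (rowsub i A)) <= kermx (rowsub i A))%MS.
    exact: row_sub.
  apply/rowP => k; rewrite [RHS]mxE; apply: (h (fun k => row l _ 0 k)) => j.
  move/rowP/(_ j): e; rewrite !mxE => {2}<-.
  by apply: eq_bigr => k' _; rewrite !mxE.
have /inj/rowP/(_ k) : (\row_k c k) *m rowsub i A = 0 *m rowsub i A.
  apply/rowP => j; rewrite mul0mx [RHS]mxE -[RHS](hc j) mxE.
  by apply: eq_bigr => k' _; rewrite !mxE.
by rewrite !mxE.
Qed.

Lemma linear_rankP (r : nat) :
  linear_rank (fun i j => A i j) r <-> r = \rank A.
Proof.
have le q (i : 'I_q -> 'I_m) :
    independent_rows (fun i j => A i j) i -> (q <= \rank A)%N.
  move=> /independent_rowsP /eqP <-; apply: mxrankS.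
  by apply/row_subP => k; rewrite row_rowsub row_sub.
have ex : exists i : 'I_(\rank A) -> 'I_m,
    independent_rows (fun i j => A i j) i.
  exists (maxrankfun A); apply/independent_rowsP.
  by rewrite maxrowsub_free.
split=> [[[i hi] ub]|->]; last by split.
apply/eqP; rewrite eqn_leq (le _ _ hi) /=.
by case: ex => j /ub.
Qed.

Lemma max_norm_has_ubound : has_ubound (entries (fun i j => A i j)).
Proof.
exists (\sum_i \sum_j `|A i j|) => _ [[i j] _ <-] /=.
rewrite (bigD1 i) //= (bigD1 j) //= -addrA lerDl addr_ge0 ?sumr_ge0 // => k _.
exact: sumr_ge0.
Qed.

Lemma max_norm_attained (i0 : 'I_m) (j0 : 'I_n) :
  exists i j, max_norm (fun i j => A i j) = `|A i j| /\
    forall k l, `|A k l| <= `|A i j|.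
Proof.
have [[i j] _ hmax] :=
  @arg_maxP _ _ _ (i0, j0) xpredT (fun p => `|A p.1 p.2|) isT.
exists i, j; split=> [|k l]; last exact: (hmax (k, l)).
apply/eqP; rewrite eq_le; apply/andP; split.
  by apply: ge_sup => [|_ [p _ <-]]; [exists `|A i j|, (i, j)|exact: hmax].
by apply: ub_le_sup; [exact: max_norm_has_ubound|exists (i, j)].
Qed.

End FiniteMatrices.

(* Main.v *)
Require Import Defs.
From mathcomp Require Import all_boot all_order all_algebra.
From mathcomp Require Import boolp classical_sets reals ereal constructive_ereal.
From mathcomp Require Import topology normedtype derive ring lra.

(* Let D = Mt - M and let q be the largest order of an invertible finite
   submatrix of D, so q <= rank M + rank Mt and every row of D is a combination
   of the q rows i_k of such a submatrix.  Among the q x q matrices Z for which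
   the functions v_k = sum_l Z_kl D(i_l, .) are bounded by B = ||D||, choose one
   of maximal |det Z| (the set of such Z is compact).  Replacing a row of Z by
   that of a row of D multiplies det Z by the corresponding coordinate, so
   D(f, s) = sum_k c_k(f) v_k(s) with |c_k(f)| <= 1 and |v_k(s)| <= B.  Hence
     B - c v = c^+ (B - v) + c^- (B + v) + (1 - |c|) B
   adds 2q nonnegative rank one terms to a factorization of Mt, giving one of
   the slack matrix for C'.  Such a factorization is turned into a formulation
   whose feasible region is the orthant, resp. the whole psd cone. *)

Set Implicit Arguments.
Unset Strict Implicit.
Unset Printing Implicit Defensive.
Import Order.TTheory GRing.Theory Num.Theory.
Import numFieldNormedType.Exports.
Local Open Scope classical_set_scope.
Local Open Scope ring_scope.

(** * Continuity, compactness and maximal determinants *)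

Lemma continuous_det (R : realType) (T : topologicalType) (q : nat)
    (A : T -> 'M[R]_q) :
  (forall i j, continuous (fun x => A x i j)) ->
  continuous (fun x => \det (A x)).
Proof.
move=> cA; apply: continuous_big; first exact: add_continuous.
move=> s _ x; apply: cvgM; first exact: cvg_cst.
by apply: continuous_big => [|i _]; [exact: mul_continuous | exact: cA].
Qed.

Lemma continuous_mulmx (R : realType) (T : topologicalType) (m n p : nat)
    (A : T -> 'M[R]_(m, n)) (B : 'M[R]_(n, p)) :
  (forall i j, continuous (fun x => A x i j)) ->
  forall i j, continuous (fun x => (A x *m B) i j).
Proof.
move=> cA i j.
have -> : (fun x => (A x *m B) i j) = fun x => \sum_k (A x i k * B k j).
  by apply/funext => x; rewrite mxE.
apply: continuous_big; first exact: add_continuous.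
by move=> k _ x; apply: cvgM; [exact: cA | exact: cvg_cst].
Qed.

Lemma closed_forall_normr_le (R : realType) (T : topologicalType) (J : Type)
    (F : J -> T -> R) (B : R) :
  (forall s, continuous (F s)) -> closed [set x | forall s, `|F s x| <= B].
Proof.
move=> cF; rewrite (_ : mkset _ =
    \bigcap_s ((fun x => `|F s x|) @^-1` [set y | y <= B])).
  apply: closed_bigI => s _; apply: preimage_closed; last exact: closed_le.
  by move=> x _; apply: continuous_comp; [exact: cF | exact: norm_continuous].
by apply/seteqP; split=> x /= h; move=> s; [move=> _|]; apply: h.
Qed.

(** Each condition on [Z] is closed, so [K] is closed however large [J] is; the entrywise bound
    makes it compact, and the continuous [|\det Z|] attains its maximum. *)
Lemma det_max (R : realType) (J : Type) (q : nat) (g : J -> 'cV[R]_q) (B N : R)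
    (Z0 : 'M[R]_q) :
  let K := [set Z : 'M[R]_q | forall s k, `|(Z *m g s) k 0| <= B] in
  (forall Z i j, K Z -> `|Z i j| <= N) -> K Z0 ->
  exists2 Z, K Z & forall Z', K Z' -> `|\det Z'| <= `|\det Z|.
Proof.
move=> K bK K0.
(* Heine-Borel is available for row vectors only. *)
pose A := [set u : 'rV[R]_(q * q) | K (vec_mx u)].
have cvec i j : continuous (fun u : 'rV[R]_(q * q) => vec_mx u i j).
  have -> : (fun u : 'rV[R]_(q * q) => vec_mx u i j) =
      fun u => u 0 (mxvec_index i j) by apply/funext => u; rewrite mxE.
  exact: coord_continuous.
have clA : closed A.
  rewrite (_ : A = [set u | forall p : J * 'I_q,
      `|(vec_mx u *m g p.1) p.2 0| <= B]); last first.
    apply/seteqP; split=> u /= h => [[s k]|s k]; first exact: h.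
    exact: (h (s, k)).
  apply: closed_forall_normr_le => -[s k] /=.
  exact: continuous_mulmx.
have bA : bounded_set A.
  (* The matrix norm is a maximum starting from 0, while [N] may be negative if [q] is 0. *)
  exists (Num.max 0 N); split; first exact: num_real.
  move=> x Nx u /= Au; rewrite [leLHS]/Num.norm /= mx_normrE.
  apply/bigmax_leP; split=> [|[i k] _ /=].
    by apply: le_trans (ltW Nx); rewrite le_max lexx.
  apply: le_trans (ltW Nx); rewrite le_max; apply/orP; right.
  case/mxvec_indexP: k => k l; rewrite ord1.
  by have := bK _ k l Au; rewrite mxE.
have cnorm (T : topologicalType) (f : T -> R) :
    continuous f -> continuous (fun x => `|f x|).
  by move=> cf x; apply: cvg_norm; exact: cf.
have A0 : A !=set0 by exists (mxvec Z0); rewrite /A /= mxvecK.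
have [||u uA umax] := @compact_EVT_max _ R
    (fun u : 'rV[R]_(q * q) => `|\det (vec_mx u)|) A A0.
- exact: bounded_closed_compact.
- apply: continuous_subspaceT; apply: cnorm; exact: continuous_det.
exists (vec_mx u); first exact: set_mem uA.
move=> Z' KZ'; have := umax (mxvec Z'); rewrite mxvecK; apply.
by rewrite inE /A /= mxvecK.
Qed.

(** * Determinant identities and Auerbach's lemma *)

(** Cramer's rule: the cofactors along row [k] do not involve that row, so they are those of [Z],
    and [Z *m \adj Z] is scalar. *)
Lemma det_replace_row (R : comRingType) (q : nat) (Z : 'M[R]_q) (c : 'rV[R]_q)
    (k : 'I_q) :
  \det (\matrix_i (if i == k then c *m Z else row i Z)) = c 0 k * \det Z.
Proof.
rewrite (expand_det_row _ k).
transitivity ((c *m Z *m \adj Z) 0 k); last first.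
  by rewrite -mulmxA mul_mx_adj mul_mx_scalar mxE mulrC.
rewrite [RHS]mxE; apply: eq_bigr => j _; rewrite mxE eqxx; congr (_ * _).
rewrite [RHS]mxE /cofactor; congr (_ * \det _).
apply/matrixP=> a b; rewrite !mxE eq_sym (negbTE (neq_lift k a)).
by rewrite !mxE.
Qed.

(** A block LU factorization shows that the determinant is [\det W] times the Schur complement
    [a - v *m invmx W *m u], which must vanish in the singular case. *)
Lemma bordered_det (R : fieldType) (q : nat) (W : 'M[R]_q) (u : 'cV[R]_q)
    (v : 'rV[R]_q) (a : 'M[R]_1) :
  W \in unitmx -> block_mx W u v a \notin unitmx -> a = v *m invmx W *m u.
Proof.
move=> uW; apply: contraNeq => na.
have -> : block_mx W u v a =
  block_mx W 0 v 1%:M *m block_mx 1%:M (invmx W *m u) 0 (a - v *m invmx W *m u).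
  rewrite mulmx_block !mulmx1 !mul0mx !mulmx0 !mul1mx !addr0.
  by rewrite mulKVmx // mulmxA addrC subrK.
rewrite unitmxE det_mulmx det_lblock det_ublock !det1 mulr1 mul1r unitrM.
rewrite -unitmxE uW /= det_mx11 unitfE; apply: contraNneq na.
move: (v *m _ *m u) => b; rewrite !mxE => /eqP; rewrite subr_eq0 => /eqP ab.
by apply/eqP/matrixP => i j; rewrite !ord1.
Qed.

Lemma auerbach_factorization (R : realType) (I J : Type) (D : I -> J -> R)
    (r : nat) (B : R) :
  (forall f s, `|D f s| <= B) ->
  (forall (q : nat) (i : 'I_q -> I) (j : 'I_q -> J),
    \matrix_(k, l) D (i k) (j l) \in unitmx -> (q <= r)%N) ->
  exists (q : nat) (c : I -> 'I_q -> R) (v : 'I_q -> J -> R),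
    [/\ (q <= r)%N, forall f k, `|c f k| <= 1, forall k s, `|v k s| <= B &
        forall f s, D f s = \sum_k c f k * v k s].
Proof.
move=> DB Dr.
pose Q q := `[< exists (i : 'I_q -> I) (j : 'I_q -> J),
  \matrix_(k, l) D (i k) (j l) \in unitmx >].
(* The empty matrix is invertible, so a largest order exists even if [D] is zero or has no
   entries. *)
have Q0 : Q 0.
  by apply/asboolP; exists (fun k : 'I_0 => False_rect _ (notF (ltn_ord k))),
    (fun k : 'I_0 => False_rect _ (notF (ltn_ord k)));
    rewrite unitmxE det_mx00 unitr1.
have Qr q : Q q -> (q <= r)%N by move=> /asboolP[i [j /Dr]].
have [q /asboolP[i [j uW]] qmax] := ex_maxnP (ex_intro _ 0 Q0) Qr.
set W := (X in X \in unitmx) in uW.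
pose g s : 'cV[R]_q := \col_k D (i k) s.
pose e f : 'rV[R]_q := \row_l D f (j l).
(* Bordering [W] by row [f] and column [s] gives a submatrix of order [q + 1], singular by
   maximality of [q]. *)
have De f s : D f s = (e f *m invmx W *m g s) 0 0.
  have := @bordered_det _ _ W (g s) (e f) (D f s)%:M uW.
  move=> <-; first by rewrite mxE.
  apply/negP => uW'; suff : Q q.+1 by move/qmax; rewrite ltnn.
  apply/asboolP.
  pose ext T (h : 'I_q -> T) (t : T) (k : 'I_(q + 1)) :=
    match split k with inl k => h k | inr _ => t end.
  rewrite -addn1; exists (ext _ i f), (ext _ j s).
  rewrite (_ : \matrix_(_, _) _ = block_mx W (g s) (e f) (D f s)%:M) //.
  apply/matrixP=> k l; rewrite /ext !mxE.
  by case: split => k'; rewrite mxE; case: split => l'; rewrite ?mxE // !ord1.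
(* The entries of [Z *m W] are among the values bounded by [B]; multiplying by [invmx W] bounds the
   entries of [Z]. *)
have gW Z a l : (Z *m W) a l = (Z *m g (j l)) a 0.
  by rewrite !mxE; apply: eq_bigr => k _; rewrite !mxE.
pose N := \sum_a \sum_b `|invmx W a b|.
have bK (Z : 'M[R]_q) (a b : 'I_q) :
    (forall s k, `|(Z *m g s) k 0| <= B) -> `|Z a b| <= q%:R * B * N.
  move=> KZ; rewrite -[Z](mulmxK uW) mxE.
  apply: le_trans (ler_norm_sum _ _ _) _.
  have B0 : 0 <= B by apply: le_trans (KZ (j a) a).
  rewrite -mulrA -[q in q%:R]card_ord mulr_natl -sumr_const.
  apply: ler_sum => l _.
  rewrite normrM gW ler_pM //.
  rewrite /N (bigD1 l) //= (bigD1 b) //= -addrA lerDl.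
  rewrite addr_ge0 ?sumr_ge0 // => k _; exact: sumr_ge0.
(* The identity is admissible because it yields rows of [D]; hence the maximal determinant is
   nonzero. *)
have K1 s k : `|(1%:M *m g s) k 0| <= B by rewrite mul1mx mxE.
have [Z KZ Zmax] := @det_max _ _ q g B _ 1%:M bK K1.
have dZ : 0 < `|\det Z|.
  by apply: lt_le_trans (Zmax _ K1); rewrite det1 normr1.
have uZ : Z \in unitmx by rewrite unitmxE unitfE -normr_gt0.
exists q, (fun f => (e f *m invmx W *m invmx Z) 0), (fun k s => (Z *m g s) k 0).
split=> [||//|f s].
- by apply: Qr; apply/asboolP; exists i, j.
(* Scaled by [|\det Z|], the claim compares [Z] with the matrix whose row [k] is [e f *m invmx W];
   this is admissible since the new row yields [D f]. *)
- move=> f k; rewrite -(ler_pM2r dZ) mul1r -normrM -det_replace_row.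
  apply: Zmax => s a.
  rewrite (_ : (_ *m _) a 0 =
    ((if a == k then e f *m invmx W else row a Z) *m g s) 0 0); last first.
    rewrite [LHS]mxE [RHS]mxE; apply: eq_bigr => l _; congr (_ * _).
    by rewrite mxE mulmxKV.
  by case: eqP => _; rewrite -?De // -row_mul mxE.
- by rewrite De -[X in X *m g s](mulmxKV uZ) -(mulmxA _ Z) mxE.
Qed.

(** * Submatrix ranks and the nonnegative correction *)

(** Rows independent on the selected columns are independent in [N], so a maximal free family of
    rows of the submatrix has at most [r] members. *)
Lemma minor_rank (R : realType) (I J : Type) (N : I -> J -> R) (r p q : nat)
    (i : 'I_p -> I) (j : 'I_q -> J) :
  linear_rank N r -> (\rank (\matrix_(k, l) N (i k) (j l)) <= r)%N.
Proof.
case=> _ Nr; set A := \matrix_(_, _) _.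
apply: (Nr _ (i \o maxrankfun A)) => c hc.
have /independent_rowsP : row_free (rowsub (maxrankfun A) A).
  exact: maxrowsub_free.
apply=> l; rewrite -[RHS](hc (j l)).
by apply: eq_bigr => k _; rewrite mxE.
Qed.

Lemma sum_mul_split (R : pzSemiRingType) (m n : nat) (F G : 'I_m -> R)
    (F' G' : 'I_n -> R) :
  \sum_k (match split k with inl k => F k | inr k => F' k end *
          match split k with inl k => G k | inr k => G' k end) =
  \sum_k F k * G k + \sum_k F' k * G' k.
Proof.
rewrite big_split_ord; congr (_ + _); apply: eq_bigr => k _.
  by rewrite -[lshift n k]/(unsplit (inl k)) unsplitK.
by rewrite -[rshift m k]/(unsplit (inr k)) unsplitK.
Qed.

Lemma nonneg_correction (R : realType) (I J : Type) (D : I -> J -> R)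
    (r q : nat) (B : R) (c : I -> 'I_q -> R) (v : 'I_q -> J -> R) :
  0 <= B -> (q <= r)%N ->
  (forall f k, `|c f k| <= 1) -> (forall k s, `|v k s| <= B) ->
  (forall f s, D f s = \sum_k c f k * v k s) ->
  exists (T : I -> 'I_(q + q) -> R) (U : 'I_(q + q) -> J -> R) (mu : I -> R),
    [/\ forall f k, 0 <= T f k, forall k s, 0 <= U k s, forall f, 0 <= mu f &
        forall f s, r%:R * B - D f s = \sum_k T f k * U k s + mu f].
Proof.
move=> B0 qr c1 vB Dcv.
pose pos (x : R) := Num.max 0 x.
have posB x : pos x - pos (- x) = x.
  by rewrite /pos; case: (leP 0 x); case: (leP 0 (- x)); lra.
have posD x : pos x + pos (- x) = `|x|.
  rewrite /pos; case: (leP 0 x) => hx; rewrite ?(ger0_norm hx) ?(ltr0_norm hx);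
    case: (leP 0 (- x)); lra.
have pos0 x : 0 <= pos x by rewrite le_max lexx.
exists (fun f k => match split k with
    inl k => pos (c f k) | inr k => pos (- c f k) end),
  (fun k s => match split k with inl k => B - v k s | inr k => B + v k s end),
  (* The surplus [(r - q) * B] and the parts [(1 - |c|) * B] are nonnegative and do not depend on
     [s], so they form [mu]. *)
  (fun f => (r - q)%:R * B + \sum_k (1 - `|c f k|) * B).
split=> [f k|k s|f|f s].
- by case: split.
- by case: split => l; have := vB l s; rewrite ler_norml => /andP[]; lra.
- rewrite addr_ge0 ?mulr_ge0 // sumr_ge0 // => k _.
  by rewrite mulr_ge0 // subr_ge0.
rewrite sum_mul_split addrCA -!big_split /= natrB // mulrBl.
rewrite (_ : \sum_(_ < q) _ = q%:R * B - D f s); first by rewrite addrA subrK.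
rewrite -[q in q%:R]card_ord mulr_natl -sumr_const Dcv -sumrB.
apply: eq_bigr => k _; rewrite -posD -{5}(posB (c f k)); ring.
Qed.

(** * From factorizations to formulations *)

Lemma min_size_addr (R : realType) (D E : set nat) (m : nat) :
  (forall n, E n -> exists2 n', D n' & (n' <= n + m)%N) ->
  (min_size R D <= min_size R E + m%:R%:E)%E.
Proof.
move=> h; rewrite -leeBlDr //; apply: le_ereal_inf_tmp => _ [n En <-].
rewrite leeBlDr //; have [n' Dn' n'n] := h _ En.
apply: ge_ereal_inf; exists (n'%:R%:E); first by exists n'.
by rewrite -EFinD lee_fin -natrD ler_nat.
Qed.

Lemma affine_cstD (R : realType) (V : lmodType R) (l : V -> R^o) (a b : R) :
  linear l -> affine (fun x => b + a * l x).
Proof.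
move=> ll; exists (fun x => a * l x), b; split=> [k x y|x]; last exact: addrC.
by rewrite ll mulrDr mulrCA.
Qed.

Section SlackFunctions.
Variables (R : realType) (P : opt_problem R) (C S : inst P -> R).
Variables (V : lmodType R) (K : set V) (x : sol P -> V).

(** Solving the slack identity for the value gives the objective: [C f - mu - l] for maximization,
    [C f + mu + l] for minimization. It serves both LP and SDP, with [K] the feasible region. *)
Lemma slack_objective (f : sound_inst S) (l : V -> R^o) (mu : R) :
  linear l -> (forall y, K y -> 0 <= l y) -> 0 <= mu ->
  (forall s, slack C f s = l (x s) + mu) ->
  exists w : V -> R, [/\ affine w, forall s, w (x s) = objval (sval f) s &
    opt_within (sense P) (w @` K) (C (sval f))].
Proof.
move=> ll l0 mu0; rewrite /slack /opt_within; case: sense => h.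
- exists (fun y => C (sval f) - mu + (-1) * l y); split.
  + exact: affine_cstD.
  + by move=> s; have := h s; lra.
  + apply: ge_ereal_sup => _ [_ [y Ky <-] <-]; rewrite lee_fin.
    by have := l0 y Ky; lra.
- exists (fun y => C (sval f) + mu + 1 * l y); split.
  + exact: affine_cstD.
  + by move=> s; have := h s; lra.
  + apply: le_ereal_inf_tmp => _ [_ [y Ky <-] <-]; rewrite lee_fin.
    by have := l0 y Ky; lra.
Qed.

End SlackFunctions.

(** The inner dimension becomes the number of inequalities [- y <= 0]; columns of [U] are the
    points, and rows of [T] are functionals nonnegative on the orthant. *)
Lemma LP_formulation_of_factorization (R : realType) (P : opt_problem R)
    (C S : inst P -> R) (n : nat) (T : sound_inst S -> 'I_n -> R)
    (U : 'I_n -> sol P -> R) (mu : sound_inst S -> R) :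
  (forall f k, 0 <= T f k) -> (forall k s, 0 <= U k s) ->
  (forall f, 0 <= mu f) ->
  (forall f s, slack C f s = \sum_k T f k * U k s + mu f) ->
  LP_formulation C S n.
Proof.
move=> T0 U0 mu0 eM.
pose x s : 'cV[R]_n := \col_k U k s.
pose K := [set y : 'cV[R]_n |
  forall i, (- 1%:M *m y) i 0 <= (0 : 'cV[R]_n) i 0].
have KE y : K y -> forall i, 0 <= y i 0.
  by move=> Ky i; have := Ky i; rewrite mulNmx mul1mx !mxE oppr_le0.
have ex (f : sound_inst S) : exists w : 'cV[R]_n -> R, [/\ affine w,
    forall s, w (x s) = objval (sval f) s &
    opt_within (sense P) (w @` K) (C (sval f))].
  apply: (@slack_objective R P C S 'cV[R]_n K x f
    (fun y => \sum_k T f k * y k 0) (mu f)).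
  - move=> a y z; rewrite scaler_sumr -big_split; apply: eq_bigr => k _.
    by rewrite !mxE mulrDr /GRing.scale /= mulrCA.
  - by move=> y Ky; apply: sumr_ge0 => k _; rewrite mulr_ge0 // KE.
  - exact: mu0.
  - by move=> s; rewrite eM; congr (_ + _); apply: eq_bigr => k _; rewrite mxE.
have [w hw] := choice ex.
exists n, (- 1%:M), 0, x, w; split=> [s i|f|f s|f].
- by rewrite mulNmx mul1mx !mxE oppr_le0.
- by have [] := hw f.
- by have [_ ->] := hw f.
- by have [] := hw f.
Qed.

(** * Positive semidefinite matrices *)

Lemma psd_block (R : realType) (n : nat) (a : 'M[R]_1) (u : 'cV[R]_n)
    (Y : 'M[R]_n) :
  psd (block_mx a u^T u Y) -> Y^T = Y /\
  forall (t : R) (w : 'cV[R]_n), 0 <= t ^+ 2 * a 0 0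
    + 2 * t * (w^T *m u) 0 0 + (w^T *m Y *m w) 0 0.
Proof.
move=> [+ posX]; rewrite tr_block_mx => /eq_block_mx[_ _ _ sY]; split=> // t w.
have := posX (col_mx t%:M w).
rewrite tr_col_mx tr_scalar_mx mul_row_block mul_row_col !mulmxDl.
rewrite !mul_scalar_mx !mul_mx_scalar -!scalemxAl.
have e : u^T *m w = (w^T *m u)^T by rewrite trmx_mul trmxK.
rewrite e !mxE.
by move=> /le_trans; apply; lra.
Qed.

(** Cholesky decomposition by induction: the Schur complement of the top left entry [al] is again
    psd. If [al] is 0 then so is [u], and the convention that 0 has inverse 0 keeps the formulas
    valid. *)
Lemma psd_gram (R : realType) (n : nat) (X : 'M[R]_n) :
  psd X -> exists V : 'M[R]_n, X = V *m V^T.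
Proof.
elim: n X => [|n IHn] X.
  by exists 0; apply/matrixP=> -[].
move=> psdX.
have [a [u [Y eX]]] : exists (a : 'M[R]_1) u (Y : 'M[R]_n),
    X = block_mx a u^T u Y.
  exists (@ulsubmx _ 1 n 1 n X), (@dlsubmx _ 1 n 1 n X),
    (@drsubmx _ 1 n 1 n X).
  by rewrite trmx_dlsub psdX.1 submxK.
move: psdX; rewrite {}eX => /psd_block[sY qE].
pose al := a 0 0; rewrite -/al in qE.
have al0 : 0 <= al.
  by have := qE 1 0; rewrite !(trmx0, mul0mx) !mxE; lra.
have u0 : al = 0 -> u = 0.
  move=> a0; have [uu0|uu0] := eqVneq ((u^T *m u) 0 0) 0.
    have /eqP : \sum_i u i 0 ^+ 2 = 0.
      by rewrite -[RHS]uu0 mxE; apply: eq_bigr => i _; rewrite mxE expr2.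
    rewrite psumr_eq0 => [/allP h|i _]; last exact: sqr_ge0.
    apply/colP => i; rewrite [RHS]mxE; apply/eqP; rewrite -sqrf_eq0.
    by apply: h; rewrite mem_index_enum.
  (* For [al] equal to 0 the form is affine in [t]; this [t] is chosen to make it -1. *)
  have := qE (- ((u^T *m Y *m u) 0 0 + 1) / (2 * (u^T *m u) 0 0)) u.
  rewrite a0 mulr0 add0r; set p := (u^T *m u) 0 0; set c := (_ *m u) 0 0.
  have -> : 2 * (- (c + 1) / (2 * p)) * p + c = -1 by field.
  by rewrite oppr_ge0 ler10.
have [|V eV] := IHn (Y - al^-1 *: (u *m u^T)).
  split=> [|w]; first by rewrite linearB linearZ /= trmx_mul trmxK sY.
  (* For positive [al] this [t] minimizes the form, and the minimum is the form of the Schur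
     complement at [w]. *)
  have := qE (- al^-1 * (w^T *m u) 0 0) w; congr (0 <= _).
  have -> : w^T *m (Y - al^-1 *: (u *m u^T)) *m w =
      w^T *m Y *m w - al^-1 *: ((w^T *m u) *m (w^T *m u)^T).
    by rewrite mulmxBr mulmxBl -scalemxAr -scalemxAl trmx_mul trmxK !mulmxA.
  move: (_ 0 0) (mx11_scalar (w^T *m u)) => p ->.
  rewrite tr_scalar_mx -scalar_mxM !mxE eqxx mulr1n.
  have [->|nz] := eqVneq al 0; first by rewrite invr0; ring.
  by field.
suff [Z ->] : exists Z : 'M[R]_(1 + n), block_mx a u^T u Y = Z *m Z^T.
  by exists Z.
exists (block_mx (Num.sqrt al)%:M 0 ((Num.sqrt al)^-1 *: u) V).
rewrite tr_block_mx mulmx_block trmx0 linearZ /= tr_scalar_mx.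
rewrite !(mulmx0, mul0mx, addr0) -scalar_mxM -expr2 sqr_sqrtr //.
rewrite mul_scalar_mx mul_mx_scalar !scalerA -eV -scalemxAl -scalemxAr scalerA.
rewrite -invfM -expr2 sqr_sqrtr // addrC subrK [a in LHS]mx11_scalar.
have [a0|a0] := eqVneq al 0; first by rewrite (u0 a0) trmx0 !scaler0.
by rewrite divff ?sqrtr_eq0 -?ltNge ?lt0r ?a0 // !scale1r.
Qed.

(** With [X] written as [V *m V^T], the trace is the sum of the values of the form of [T] at the
    columns of [V]. *)
Lemma psd_mxtrace_ge0 (R : realType) (n : nat) (T X : 'M[R]_n) :
  psd T -> psd X -> 0 <= \tr (T *m X).
Proof.
move=> [_ T0] /psd_gram[V ->]; rewrite mulmxA mxtrace_mulC mulmxA.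
apply: sumr_ge0 => j _; have := T0 (col j V); congr (0 <= _).
rewrite [LHS]mxE [RHS]mxE; apply: eq_bigr => k _.
by rewrite tr_col -row_mul !mxE.
Qed.

(** This lets nonnegative scalar factors be appended to psd factors as diagonal entries. *)
Lemma psd_block_diag (R : realType) (n m : nat) (X : 'M[R]_n) (d : 'rV[R]_m) :
  psd X -> (forall k, 0 <= d 0 k) -> psd (block_mx X 0 0 (diag_mx d)).
Proof.
move=> [sX X0] d0; split=> [|v].
  by rewrite tr_block_mx !trmx0 sX tr_diag_mx.
rewrite -[v]vsubmxK; move: (usubmx v) (dsubmx v) => y z.
rewrite tr_col_mx mul_row_block mul_row_col !mulmx0 addr0 add0r mxE addr_ge0 //.
rewrite mul_mx_diag mxE sumr_ge0 // => k _.
by rewrite !mxE mulrAC -expr2 mulr_ge0 ?sqr_ge0.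
Qed.

Lemma SDP_formulation_of_factorization (R : realType) (P : opt_problem R)
    (C S : inst P -> R) (d : nat) (T : sound_inst S -> 'M[R]_d)
    (U : sol P -> 'M[R]_d) (mu : sound_inst S -> R) :
  (forall f, psd (T f)) -> (forall s, psd (U s)) -> (forall f, 0 <= mu f) ->
  (forall f s, slack C f s = \tr (T f *m U s) + mu f) ->
  SDP_formulation C S d.
Proof.
move=> T0 U0 mu0 eM.
have symU s : U s \in @is_symmx R d.
  by rewrite unfold_in; apply/eqP; case: (U0 s).
pose X s := SymMx (symU s).
(* The equation lives in dimension 0, so it holds trivially and [K] is the whole psd cone. *)
pose K := [set Y : symmx R d | psd (symmx_val Y) /\ (0 : 'cV[R]_0) = 0].
have ex (f : sound_inst S) : exists w : symmx R d -> R, [/\ affine w,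
    forall s, w (X s) = objval (sval f) s &
    opt_within (sense P) (w @` K) (C (sval f))].
  apply: (@slack_objective R P C S (symmx R d) K X f
    (fun Y => \tr (T f *m symmx_val Y)) (mu f)) => //.
  - move=> a Y Z; have -> :
        symmx_val (a *: Y + Z) = a *: symmx_val Y + symmx_val Z.
      exact: (linearP val).
    by rewrite mulmxDr -scalemxAr linearP.
  - by move=> Y [Y0 _]; exact: psd_mxtrace_ge0.
have [w hw] := choice ex.
exists 0, (fun=> 0), 0, X, w; split.
  by move=> a Y Z; rewrite scaler0 addr0.
split=> [s|f|f s|f].
- by split; [exact: U0|].
- by have [] := hw f.
- by have [_ ->] := hw f.
- by have [] := hw f.
Qed.

Lemma slack_adjusted (R : realType) (P : opt_problem R) (C S : inst P -> R)
    (t : R) (f : sound_inst S) (s : sol P) :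
  slack (adjusted C t) f s = slack C f s + t.
Proof. by rewrite /slack /adjusted; case: sense; ring. Qed.

Theorem theorem7p2 (R : realType) (P : opt_problem R) (C S : inst P -> R)
    (Mt : sound_inst S -> sol P -> R) (r rt : nat) :
  let M := slack C (S := S) in
  let D := fun f s => Mt f s - M f s in
  (forall f s, 0 <= Mt f s) ->
  linear_rank M r ->
  linear_rank Mt rt ->
  has_ubound (entries D) ->
  let C' := adjusted C ((r + rt)%:R * max_norm D) in
  (fc C' S <= rank_LP Mt + (2 * (r + rt))%:R%:E)%E /\
  (fc_plus C' S <= rank_SDP Mt + (2 * (r + rt))%:R%:E)%E.
Proof.
move=> M D _ Mr Mtr Dub C'.
have DB f s : `|D f s| <= max_norm D by apply: ub_le_sup => //; exists (f, s).
have B0 : 0 <= max_norm D.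
  have [[[f s]]|none] := pselect (inhabited (sound_inst S * sol P)).
    by apply: le_trans (DB f s).
  (* Without entries the norm is the supremum of the empty set, which is 0 by convention. *)
  rewrite /max_norm (_ : entries D = set0) ?sup0 //.
  by apply/seteqP; split=> // x [p]; case: none; exists.
have Dr q (i : 'I_q -> sound_inst S) (j : 'I_q -> sol P) :
    \matrix_(k, l) D (i k) (j l) \in unitmx -> (q <= r + rt)%N.
  (* A submatrix of [D] is a difference of submatrices of [Mt] and [M], and rank is subadditive. *)
  move=> /mxrank_unit/esym rkD; apply: (leq_trans (eq_leq rkD)).
  apply: leq_trans (leq_add (minor_rank i j Mr) (minor_rank i j Mtr)).
  rewrite addnC -[X in (_ <= _ + X)%N]mxrank_opp.
  apply: leq_trans (mxrank_add _ _); apply/eq_leq; congr (\rank _).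
  by apply/matrixP=> k l; rewrite !mxE.
have [q [c [v [qr c1 vB eD]]]] := auerbach_factorization DB Dr.
have [T [U [mu [T0 U0 mu0 eTU]]]] := nonneg_correction B0 qr c1 vB eD.
have eM' f s : slack C' f s = Mt f s + \sum_k T f k * U k s + mu f.
  by rewrite slack_adjusted -addrA -eTU /D /M; ring.
have size_le n : (n + (q + q) <= n + 2 * (r + rt))%N.
  by rewrite leq_add2l addnn -mul2n leq_mul2l.
split; apply: min_size_addr => n [T1 [U1 [mu1 [T10 U10 mu10 e1]]]];
  exists (n + (q + q))%N => //.
- apply: (@LP_formulation_of_factorization _ _ _ _ _
    (fun f k => match split k with inl k => T1 f k | inr k => T f k end)
    (fun k s => match split k with inl k => U1 k s | inr k => U k s end)
    (fun f => mu1 f + mu f)).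
  + by move=> f k; case: split.
  + by move=> k s; case: split.
  + by move=> f; rewrite addr_ge0.
  by move=> f s; rewrite eM' e1 sum_mul_split; ring.
(* The trace of a product of block diagonal matrices adds up blockwise, so the [q + q] rank one
   terms cost [q + q] diagonal entries. *)
- apply: (@SDP_formulation_of_factorization _ _ _ _ _
    (fun f => block_mx (T1 f) 0 0 (diag_mx (\row_k T f k)))
    (fun s => block_mx (U1 s) 0 0 (diag_mx (\row_k U k s)))
    (fun f => mu1 f + mu f)).
  + by move=> f; apply: psd_block_diag => // k; rewrite mxE.
  + by move=> s; apply: psd_block_diag => // k; rewrite mxE.
  + by move=> f; rewrite addr_ge0.
  move=> f s; rewrite eM' e1 mulmx_block !mulmx0 !mul0mx !addr0 !add0r.
  rewrite mxtrace_block mulmx_diag mxtrace_diag.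
  rewrite [X in _ = _ + X + _](eq_bigr (fun k => T f k * U k s)); last first.
    by move=> k _; rewrite !mxE.
  ring.
Qed.
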